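(* Fix $p\in(0,1)$ and, for each $n\ge 1$, let $\mu$ be the $p$-biased measure on $\{-1,1\}^n$ and let $f_n:\{-1,1\}^n\to\mathbb{R}$, with $f_n^{(i)}=f_n-E_i[f_n]$ for $1\le i\le n$. Suppose that $\mathrm{var}(f_n)>0$ for all $n$ and that $\mathrm{var}(f_n)=o(n^{\varepsilon})$ as $n\to\infty$ for every $\varepsilon>0$. Then $$\liminf_{n\to\infty}\frac{\max_{1\le i\le n}\lVert f_n^{(i)}\rVert_1}{\mathrm{var}(f_n)\,\frac{\ln n}{n}}\;\ge\;\frac{9}{20}\cdot\frac{1}{\sup_n\lVert f_n\rVert_\infty}\cdot\frac{1}{1+\left|\ln\frac{p}{1-p}\right|},$$ where the right-hand side is interpreted as $0$ if $\sup_n\lVert f_n\rVert_\infty=\infty$.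
   Context: The $p$-biased measure on $\{-1,1\}^n$ is the product probability measure under which each coordinate independently equals $1$ with probability $p$ and $-1$ with probability $1-p$. Norms and variances are with respect to $\mu$: $\lVert f\rVert_1=\int|f|\,d\mu$, $\lVert f\rVert_\infty=\max_x|f(x)|$, $\mathrm{var}(f)=E[f^2]-E[f]^2$. $E_i[f]$ denotes integration of $f$ over the $i$-th coordinate only, the other coordinates being held fixed. *)

(* Defs.v *)
From HB Require Import structures.
From mathcomp Require Import all_boot all_order all_algebra.
From mathcomp Require Import all_classical all_reals all_analysis.

Set Implicit Arguments.
Unset Strict Implicit.
Unset Printing Implicit Defensive.

Import Order.TTheory GRing.Theory Num.Theory.
Import numFieldNormedType.Exports.

Local Open Scope ring_scope.

(* A point of {-1,1}^n: the coordinate value 1 is encoded by true, the        *)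
(* coordinate value -1 by false.                                              *)
Definition cube (n : nat) : finType := {ffun 'I_n -> bool}.

Section Biased.
Context {R : realType}.
Implicit Type p : R.

Definition bias1 p (b : bool) : R := if b then p else 1 - p.

(* mass of the point x under the p-biased product measure *)
Definition bias p {n : nat} (x : cube n) : R := \prod_(i < n) bias1 p (x i).

Definition biased_mean p {n : nat} (f : cube n -> R) : R :=
  \sum_(x : cube n) bias p x * f x.

Definition biased_var p {n : nat} (f : cube n -> R) : R :=
  biased_mean p (fun x => f x ^+ 2) - biased_mean p f ^+ 2.

Definition norm1 p {n : nat} (f : cube n -> R) : R := biased_mean p (fun x => `|f x|).

(* Here and in maxnorm1 the default value 0 of the maximum is harmless, since *)
(* the family is nonnegative.                                                 *)
Definition norm_sup {n : nat} (f : cube n -> R) : R :=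
  \big[Num.max/0]_(x : cube n) `|f x|.

Definition set_coord {n : nat} (x : cube n) (i : 'I_n) (b : bool) : cube n :=
  [ffun j => if j == i then b else x j].

Definition mean_coord p {n : nat} (i : 'I_n) (f : cube n -> R) : cube n -> R :=
  fun x => \sum_(b : bool) bias1 p b * f (set_coord x i b).

Definition dev p {n : nat} (i : 'I_n) (f : cube n -> R) : cube n -> R :=
  fun x => f x - mean_coord p i f x.

Definition maxnorm1 p {n : nat} (f : cube n -> R) : R :=
  \big[Num.max/0]_(i < n) norm1 p (dev p i f).

End Biased.

(* Main.v *)
(* Write t = |ln (p / (1 - p))|. The p-biased cube satisfies the logarithmic       *)
(* Sobolev inequality Ent(g^2) <= 2 (1 + t) sum_i |g^(i)|_2^2: the two-point case  *)
(* tensorizes. Following Falik and Samorodnitsky, apply it to the martingale       *)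
(* differences V_j = E_1 ... E_(j-1) f^(j) of f. Their energies add up to those of *)
(* f, |V_j|_1 <= |f^(j)|_1, and Ent(V^2) >= |V|_2^2 ln (|V|_2^2 / |V|_1^2), so     *)
(*   var f * ln (var f / sum_j |f^(j)|_1^2) <= 2 (1 + t) sum_i |f^(i)|_2^2.        *)
(* Moreover |f^(i)|_2^2 = E[f f^(i)] <= |f|_oo |f^(i)|_1. When all |f^(i)|_1 are    *)
(* below k var f (ln n / n) and var f = n^o(1), the logarithm is (1 - o(1)) ln n,  *)
(* hence k >= (1 - o(1)) / (2 (1 + t) |f|_oo); the constant 9/20 < 1/2 leaves room *)
(* for the o(1).                                                                   *)

Require Import Defs.
From mathcomp Require Import all_boot all_order all_algebra.
From mathcomp Require Import all_classical all_reals all_analysis.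
From mathcomp Require Import ring lra.

Set Implicit Arguments.
Unset Strict Implicit.
Unset Printing Implicit Defensive.

Import Order.TTheory GRing.Theory Num.Theory.
Import numFieldNormedType.Exports.

Local Open Scope classical_set_scope.
Local Open Scope ring_scope.

(** * Derivative tests and one-variable logarithm inequalities *)

Section Calculus.
Context {R : realType}.
Implicit Types r x y : R.

Lemma le_of_derive_ge0 (f g : R -> R) x0 x :
  (forall y, x0 <= y -> is_derive y (1 : R) f (g y)) ->
  (forall y, x0 < y -> 0 <= g y) -> x0 <= x -> f x0 <= f x.
Proof.
move=> df g0 lex.
apply: (@ger0_derive1_ndecry _ f x0) => //.
- by move=> y; rewrite in_itv/= andbT => /ltW/df [].
- move=> y; rewrite in_itv/= andbT => xy.
  by rewrite derive1E (@derive_val _ _ _ _ _ _ _ (df _ (ltW xy))) g0.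
- apply: derivable_within_continuous => y; rewrite in_itv/= andbT => xy.
  by case: (df _ xy).
Qed.

Lemma ln_le_subr1 x : 0 < x -> ln x <= x - 1.
Proof. by move=> x0; rewrite -{1}(subrKC 1 x) le_ln1Dx// ltrBrDl subrr. Qed.

(** Both sides vanish at 1, and the derivative of their difference is [2 * (x - 1 - ln x)]. Near 1
    this is sharper than [ln_le_subr1]. *)
Lemma mul_ln_le_sqr x : 1 <= x -> 2 * x * ln x <= x ^+ 2 - 1.
Proof.
move=> x1; set f := fun y : R => y ^+ 2 - 1 - 2 * y * ln y.
suff : f 1 <= f x by rewrite /f ln1; lra.
apply: (@le_of_derive_ge0 f (fun y => 2 * y - 2 * ln y - 2) 1 x _ _ x1) => y y1.
  have dln := is_derive1_ln (lt_le_trans ltr01 y1).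
  apply: is_derive_eq; rewrite /GRing.scale/=.
  by field; apply: lt0r_neq0; apply: lt_le_trans y1.
have := ln_le_subr1 (lt_trans ltr01 y1); lra.
Qed.

Lemma is_derive_ln_comp (f : R -> R) x (d : R) : 0 < f x ->
  is_derive x (1 : R) f d -> is_derive x (1 : R) (fun y => ln (f y)) ((f x)^-1 * d).
Proof.
move=> f0 df; have dln := is_derive1_ln f0.
by have := @is_derive1_comp _ (@ln R) f x _ _ dln df.
Qed.

(** Passage from the unbiased case [r = 1] to [r = (1 - p) / p]: the extra cost is at most
    [(1 - y) * ln r], the origin of the term |ln (p / (1 - p))| in the constant. Equality holds at
    [r = 1], and the difference is nondecreasing in [r]. *)
Lemma ln_ratio_le y r : 0 <= y -> y <= 1 -> 1 <= r ->
  ln (1 + r) - ln (1 + r * y ^+ 2) <=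
  ln 2 - ln (1 + y ^+ 2) + (1 - y) * ln r.
Proof.
move=> y0 y1 r1.
set f := fun s : R => (1 - y) * ln s - (ln (1 + s) - ln (1 + s * y ^+ 2)).
suff : f 1 <= f r by rewrite /f ln1 mul1r; lra.
have pos s : 1 <= s -> 0 < s /\ 0 < 1 + s /\ 0 < 1 + s * y ^+ 2.
  move=> s1; have s0 : 0 < s by lra.
  by have := mulr_ge0 (ltW s0) (sqr_ge0 y); split => //; split; lra.
apply: (@le_of_derive_ge0 f
  (fun s => (1 - y) * s^-1 - ((1 + s)^-1 - y ^+ 2 * (1 + s * y ^+ 2)^-1)) 1 r _ _ r1) => s s1.
  have [s0 [s2 s3]] := pos _ s1.
  have d1 := is_derive1_ln s0.
  have d2 : is_derive s (1 : R) (fun s : R => ln (1 + s)) ((1 + s)^-1 * 1).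
    by apply: is_derive_ln_comp => //; apply: is_derive_eq; rewrite add0r.
  have d3 : is_derive s (1 : R) (fun s : R => ln (1 + s * y ^+ 2))
      ((1 + s * y ^+ 2)^-1 * y ^+ 2).
    apply: (@is_derive_ln_comp (fun s : R => 1 + s * y ^+ 2)) => //.
    by apply: is_derive_eq; rewrite /GRing.scale/=; ring.
  by apply: is_derive_eq; rewrite /GRing.scale/=; ring.
have [s0 [s2 s3]] := pos _ (ltW s1).
have -> : (1 - y) / s - ((1 + s)^-1 - y ^+ 2 / (1 + s * y ^+ 2)) =
   (1 - y) * ((1 - s * y) ^+ 2 + s * y * (1 + y))
   / (s * (1 + s) * (1 + s * y ^+ 2)).
  by field; rewrite !lt0r_neq0.
apply: divr_ge0; last by rewrite !mulr_ge0 ?ltW.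
apply: mulr_ge0; first lra.
by rewrite addr_ge0 ?sqr_ge0// !mulr_ge0 ?addr_ge0// ltW.
Qed.

End Calculus.

(** * The logarithmic Sobolev inequality on the biased two-point space *)

Section TwoPoint.
Context {R : realType}.
Implicit Types p a b y : R.

Definition lsi_const p : R := 2 * (1 + `|ln (p / (1 - p))|).

Lemma lsi_const_ge2 p : 2 <= lsi_const p.
Proof. by have := normr_ge0 (ln (p / (1 - p))); rewrite /lsi_const; lra. Qed.

Lemma lsi_constC p : 0 < p -> p < 1 -> lsi_const (1 - p) = lsi_const p.
Proof.
move=> p0 p1; rewrite /lsi_const subKr -invf_div lnV ?normrN//.
by rewrite posrE divr_gt0 ?subr_gt0.
Qed.

Lemma convex_pos p a b : 0 < p -> p < 1 -> 0 < a -> 0 <= b -> 0 < p * a + (1 - p) * b.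
Proof.
move=> p0 p1 a0 b0; have q0 : 0 <= 1 - p by lra.
by have := mulr_gt0 p0 a0; have := mulr_ge0 q0 b0; lra.
Qed.

(** With z the argument of the logarithm, [mul_ln_le_sqr] at 1/z bounds -ln z by (1 - z^2) / (2z).
    What remains is polynomial and follows from z >= (1 + y^2) / 2. *)
Lemma neg_ln_le_half p y : 1 / 2 <= p -> p < 1 -> 0 <= y -> y <= 1 ->
  - ln (p + (1 - p) * y ^+ 2) <= 2 * (1 - p) * (1 - y).
Proof.
move=> p2 p1 y0 y1; set z := p + _.
have y21 : 0 <= 1 - y ^+ 2 by rewrite subr_ge0 expr_le1.
have qy : 0 <= (1 - p) * (1 - y ^+ 2) by apply: mulr_ge0; lra.
have z1 : z <= 1 by rewrite /z; lra.
have zh : (1 + y ^+ 2) / 2 <= z.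
  rewrite -subr_ge0 /z.
  have -> : p + (1 - p) * y ^+ 2 - (1 + y ^+ 2) / 2 = (p - 1 / 2) * (1 - y ^+ 2).
    by field.
  by apply: mulr_ge0; lra.
have z0 : 0 < z by apply: lt_le_trans zh; have := sqr_ge0 y; lra.
have lnz : - ln z * (2 * z) <= 1 - z ^+ 2.
  have := @mul_ln_le_sqr _ z^-1; rewrite invf_ge1// => /(_ z1).
  rewrite lnV// -(ler_pM2r (exprn_gt0 2 z0)).
  have -> : 2 * z^-1 * - ln z * z ^+ 2 = - ln z * (2 * z) by field; exact: lt0r_neq0.
  by have -> : (z^-1 ^+ 2 - 1) * z ^+ 2 = 1 - z ^+ 2 by field; exact: lt0r_neq0.
have z2 : 0 < 2 * z by lra.
rewrite -(ler_pM2r z2) (le_trans lnz)// -subr_ge0.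
have -> : 2 * (1 - p) * (1 - y) * (2 * z) - (1 - z ^+ 2) =
    (1 - p) * (1 - y) * (z * (3 - y) - (1 + y)) by rewrite /z; ring.
apply: mulr_ge0; first by apply: mulr_ge0; lra.
have y3 : 0 <= 3 - y by lra.
(* At z = (1 + y^2) / 2 the last factor z(3 - y) - (1 + y) equals (1 - y)^3 / 2. *)
have := ler_wpM2r y3 zh; have : 0 <= (1 - y) ^+ 3 by rewrite exprn_ge0// subr_ge0.
lra.
Qed.

(** This is the sign condition on the derivative in [lsi_ge1], with y = 1/s. For p < 1/2,
    [ln_ratio_le] and the case p = 1/2 give the bound (1 - y)(1 + ln r), and 1 <= 2(1 - p). *)
Lemma neg_ln_le p y : 0 < p -> p < 1 -> 0 <= y -> y <= 1 ->
  - ln (p + (1 - p) * y ^+ 2) <= lsi_const p * (1 - p) * (1 - y).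
Proof.
move=> p0 p1 y0 y1; have qy : 0 <= (1 - p) * (1 - y) by apply: mulr_ge0; lra.
have [p2|p2] := leP (1 / 2) p.
  have := neg_ln_le_half p2 p1 y0 y1.
  by have := ler_wpM2r qy (lsi_const_ge2 p); lra.
set r := (1 - p) / p.
have r1 : 1 <= r by rewrite ler_pdivlMr//; lra.
have r0 : 0 < r by lra.
have y20 := sqr_ge0 y; have ry := mulr_ge0 (ltW r0) y20.
have -> : p + (1 - p) * y ^+ 2 = (1 + r * y ^+ 2) / (1 + r).
  by rewrite /r; field; rewrite lt0r_neq0//= lt0r_neq0//; lra.
rewrite ln_div ?posrE; try lra.
rewrite opprB (le_trans (ln_ratio_le y0 y1 r1))//.
have h1 : 1 / 2 <= 1 / 2 :> R by [].
have h2 : (1 / 2 : R) < 1 by lra.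
have := neg_ln_le_half h1 h2 y0 y1.
have -> : 1 / 2 + (1 - 1 / 2) * y ^+ 2 = (1 + y ^+ 2) / 2 by field.
rewrite ln_div ?posrE; try lra.
move=> lny.
have tE : `|ln (p / (1 - p))| = ln r.
  by rewrite -invf_div lnV ?posrE// normrN ger0_norm// ln_ge0.
have lr : 0 <= ln r by rewrite ln_ge0.
have : 0 <= (1 - y) * (1 + ln r) * (1 - 2 * p).
  by rewrite !mulr_ge0//; lra.
by rewrite /lsi_const tE; lra.
Qed.

(** The two-point inequality for the values a and 1. The gap vanishes at a = 1, and its derivative
    at s is 2ps times the gap in [neg_ln_le] at y = 1/s. *)
Lemma lsi_ge1 p a : 0 < p -> p < 1 -> 1 <= a ->
  2 * p * a ^+ 2 * ln a - (p * a ^+ 2 + (1 - p)) * ln (p * a ^+ 2 + (1 - p)) <=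
  lsi_const p * p * (1 - p) * (a - 1) ^+ 2.
Proof.
move=> p0 p1 a1; rewrite -subr_ge0.
set c := lsi_const p.
pose m := fun s : R => p * s ^+ 2 + (1 - p).
set f := fun s : R => c * p * (1 - p) * (s - 1) ^+ 2 -
  (2 * p * s ^+ 2 * ln s - m s * ln (m s)).
have f1 : f 1 = 0.
  rewrite /f /m ln1; have -> : p * 1 ^+ 2 + (1 - p) = 1 by ring.
  by rewrite ln1; ring.
rewrite -[_ - _]/(f a) -f1.
have m0 s : 1 <= s -> 0 < m s.
  move=> s1; rewrite /m -[X in _ + X]mulr1; apply: convex_pos => //.
  by rewrite exprn_gt0//; lra.
apply: (@le_of_derive_ge0 _ f
   (fun s => 2 * p * (c * (1 - p) * (s - 1) - s * (2 * ln s - ln (m s)))) 1 a _ _ a1) => s s1.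
  have s0 : 0 < s by lra.
  have d1 := is_derive1_ln s0.
  have dm : is_derive s (1 : R) m (2 * p * s).
    by apply: is_derive_eq; rewrite /GRing.scale/=; ring.
  have d2 := is_derive_ln_comp (m0 _ s1) dm.
  apply: is_derive_eq; rewrite /GRing.scale/=.
  by field; rewrite !lt0r_neq0// m0.
have s0 : 0 < s by lra.
apply: mulr_ge0; first lra.
have mE : ln (m s) = 2 * ln s + ln (p + (1 - p) * s^-1 ^+ 2).
  have -> : m s = s ^+ 2 * (p + (1 - p) * s^-1 ^+ 2).
    by rewrite /m; field; exact: lt0r_neq0.
  rewrite lnM ?posrE ?exprn_gt0//; last first.
    rewrite -[X in X + _]mulr1; apply: convex_pos => //.
    exact: sqr_ge0.
  by rewrite lnXn//; ring.
have sV : s^-1 <= 1 by rewrite invf_le1// ltW.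
have sV0 : 0 <= s^-1 by rewrite invr_ge0 ltW.
have := neg_ln_le p0 p1 sV0 sV; rewrite -(ler_pM2l s0).
have -> : s * (lsi_const p * (1 - p) * (1 - s^-1)) = c * (1 - p) * (s - 1).
  by rewrite /c; field; exact: lt0r_neq0.
by rewrite mE; lra.
Qed.

(** Both sides are homogeneous of degree 2, so b > 0 reduces to b = 1; the case b = 0 is [neg_ln_le]
    at y = 0. *)
Lemma lsi_two_point_ge p a b : 0 < p -> p < 1 -> 0 <= b -> b <= a ->
  p * a ^+ 2 * ln (a ^+ 2) + (1 - p) * b ^+ 2 * ln (b ^+ 2) -
  (p * a ^+ 2 + (1 - p) * b ^+ 2) * ln (p * a ^+ 2 + (1 - p) * b ^+ 2) <=
  lsi_const p * p * (1 - p) * (a - b) ^+ 2.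
Proof.
move=> p0 p1; rewrite le_eqVlt => /predU1P[<- a0|b0 ba].
  rewrite expr0n/= !(mulr0, mul0r, addr0) subr0.
  have [->|a_gt0] := eqVneq a 0; first by rewrite expr0n/=; lra.
  have a2 : 0 < a ^+ 2 by rewrite exprn_gt0// lt0r a_gt0.
  rewrite lnM//.
  have := @neg_ln_le p 0 p0 p1 (lexx 0) ler01.
  rewrite expr0n/= mulr0 addr0 subr0 mulr1 -(ler_pM2l (mulr_gt0 p0 a2)).
  lra.
set s := a / b; have s1 : 1 <= s by rewrite ler_pdivlMr// mul1r.
have s0 : 0 < s by lra.
have -> : a = b * s by rewrite /s; field; exact: lt0r_neq0.
have b2 : 0 < b ^+ 2 by rewrite exprn_gt0.
have ms : 0 < p * s ^+ 2 + (1 - p).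
  by rewrite -[X in _ + X]mulr1; apply: convex_pos; rewrite ?exprn_gt0.
have -> : p * (b * s) ^+ 2 + (1 - p) * b ^+ 2 = b ^+ 2 * (p * s ^+ 2 + (1 - p)) by ring.
rewrite exprMn (lnM (x := b ^+ 2) (y := s ^+ 2)) ?posrE ?exprn_gt0// lnM//.
rewrite (lnXn _ s0).
have := lsi_ge1 p0 p1 s1; rewrite -(ler_pM2l b2); lra.
Qed.

Lemma lsi_two_point p a b : 0 < p -> p < 1 -> 0 <= a -> 0 <= b ->
  p * a ^+ 2 * ln (a ^+ 2) + (1 - p) * b ^+ 2 * ln (b ^+ 2) -
  (p * a ^+ 2 + (1 - p) * b ^+ 2) * ln (p * a ^+ 2 + (1 - p) * b ^+ 2) <=
  lsi_const p * p * (1 - p) * (a - b) ^+ 2.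
Proof.
move=> p0 p1 a0 b0; have [ba|/ltW ab] := leP b a; first exact: lsi_two_point_ge.
have q0 : 0 < 1 - p by lra.
have q1 : 1 - p < 1 by lra.
have := lsi_two_point_ge q0 q1 a0 ab; rewrite lsi_constC// subKr.
by rewrite (addrC ((1 - p) * b ^+ 2)) => h; lra.
Qed.

End TwoPoint.

(** * Coordinate averages and differences on the biased cube *)

Section Cube.
Context {R : realType} (p : R) {n : nat}.
Hypotheses (p0 : 0 < p) (p1 : p < 1).
Implicit Types (f g : cube n -> R) (x y : cube n) (i j k : 'I_n).

Local Notation E := (@biased_mean R p n).
Local Notation Ei := (@mean_coord R p n).
Local Notation D := (@dev R p n).
Local Notation nrm1 := (@norm1 R p n).

Let q0 : 0 < 1 - p. Proof. by rewrite subr_gt0. Qed.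

Lemma bias1_ge0 b : 0 <= bias1 p b.
Proof. by case: b => /=; exact: ltW. Qed.

Lemma bias_ge0 x : 0 <= bias p x.
Proof. by apply: prodr_ge0 => i _; exact: bias1_ge0. Qed.

Lemma bias1_sum : \sum_(b : bool) bias1 p b = 1.
Proof. by rewrite big_bool /=; ring. Qed.

Lemma bias_sum : \sum_(x : cube n) bias p x = 1.
Proof.
rewrite /bias -(bigA_distr_bigA (fun (i : 'I_n) b => bias1 p b)) big1// => i _.
exact: bias1_sum.
Qed.

Lemma eq_mean f g : f =1 g -> E f = E g.
Proof. by move=> fg; apply: eq_bigr => x _; rewrite fg. Qed.

Lemma mean_cst (c : R) : E (fun=> c) = c.
Proof. by rewrite /biased_mean -mulr_suml bias_sum mul1r. Qed.

Lemma meanD f g : E (fun x => f x + g x) = E f + E g.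
Proof. by rewrite -big_split; apply: eq_bigr => x _; rewrite mulrDr. Qed.

Lemma meanZ (c : R) f : E (fun x => c * f x) = c * E f.
Proof. by rewrite mulr_sumr; apply: eq_bigr => x _; rewrite mulrCA. Qed.

Lemma meanB f g : E (fun x => f x - g x) = E f - E g.
Proof. by rewrite -sumrB; apply: eq_bigr => x _; rewrite mulrBr. Qed.

Lemma le_mean f g : (forall x, f x <= g x) -> E f <= E g.
Proof. by move=> fg; apply: ler_sum => x _; exact: ler_wpM2l (bias_ge0 x) _ _ (fg x). Qed.

Lemma mean_ge0 f : (forall x, 0 <= f x) -> 0 <= E f.
Proof. by move=> f0; apply: sumr_ge0 => x _; rewrite mulr_ge0// bias_ge0. Qed.

Lemma set_coord_id x i b c : set_coord (set_coord x i b) i c = set_coord x i c.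
Proof. by apply/ffunP => j; rewrite !ffunE; case: eqP. Qed.

Lemma set_coordC x i j b c : i != j ->
  set_coord (set_coord x i b) j c = set_coord (set_coord x j c) i b.
Proof.
move=> ij; apply/ffunP => k; rewrite !ffunE.
by case: (eqVneq k j) => // ->; rewrite eq_sym (negPf ij).
Qed.

Lemma set_coord_self x i : set_coord x i (x i) = x.
Proof. by apply/ffunP => j; rewrite ffunE; case: eqP => [->|]. Qed.

Lemma mean_coordE i f x :
  Ei i f x = p * f (set_coord x i true) + (1 - p) * f (set_coord x i false).
Proof. by rewrite /mean_coord big_bool. Qed.

Lemma mean_coord_id i f x b : Ei i f (set_coord x i b) = Ei i f x.
Proof. by rewrite !mean_coordE !set_coord_id. Qed.

Lemma mean_coordC i j f x : Ei i (Ei j f) x = Ei j (Ei i f) x.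
Proof.
have [->//|ij] := eqVneq i j.
by rewrite !mean_coordE !(set_coordC _ _ _ ij); ring.
Qed.

Lemma mean_coordM i f g x : Ei i (fun y => f y * Ei i g y) x = Ei i f x * Ei i g x.
Proof. by rewrite mean_coordE !mean_coord_id [Ei i f x]mean_coordE; ring. Qed.

Lemma mean_coord_ge0 i f x : (forall y, 0 <= f y) -> 0 <= Ei i f x.
Proof. by move=> f0; apply: sumr_ge0 => b _; rewrite mulr_ge0// bias1_ge0. Qed.

Let flip i x : cube n := set_coord x i (~~ x i).

Let flipK i : involutive (flip i).
Proof.
move=> x; rewrite /flip set_coord_id ffunE eqxx negbK; exact: set_coord_self.
Qed.

Let bias_flip i x : bias p (flip i x) * bias1 p (x i) = bias p x * bias1 p (~~ x i).
Proof.
rewrite /bias !(bigD1 i (P := predT))//= ffunE eqxx.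
rewrite [X in _ * X * _](_ : _ = \prod_(j < n | j != i) bias1 p (x j)); last first.
  by apply: eq_bigr => j ji; rewrite ffunE (negPf ji).
by ring.
Qed.

(* Pairing x with its flip at i reduces the claim to bias1 p true + bias1 p false = 1. *)
Lemma mean_mean_coord i f : E (Ei i f) = E f.
Proof.
have EiE x : Ei i f x = bias1 p (x i) * f x + bias1 p (~~ x i) * f (flip i x).
  rewrite mean_coordE /flip; have := set_coord_self x i.
  by case: (x i) => /= ->//; rewrite addrC.
rewrite (eq_mean EiE) meanD.
have -> : E (fun x => bias1 p (~~ x i) * f (flip i x)) = E (fun x => bias1 p (~~ x i) * f x).
  rewrite /biased_mean (reindex_inj (inv_inj (flipK i))).
  apply: eq_bigr => x _; rewrite flipK mulrA mulrA.
  by rewrite {2}/flip ffunE eqxx negbK bias_flip.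
rewrite -meanD; apply: eq_mean => x.
by case: (x i) => /=; ring.
Qed.

(** Pythagoras for the orthogonal projection [mean_coord p i], checked on each fibre of coordinate
    i. *)
Lemma mean_dev_sqr i f : E (fun x => D i f x ^+ 2) =
  E (fun x => f x ^+ 2) - E (fun x => Ei i f x ^+ 2).
Proof.
rewrite -(mean_mean_coord i) -[E (fun x => f x ^+ 2)](mean_mean_coord i) -meanB.
apply: eq_mean => x.
rewrite !mean_coordE /dev !mean_coord_id mean_coordE; ring.
Qed.

Lemma devC i j f x : D i (D j f) x = D j (D i f) x.
Proof.
have [->//|ij] := eqVneq i j.
by rewrite /dev !mean_coordE !(set_coordC _ _ _ ij); ring.
Qed.

Lemma dev_mean_coord i j f x : D i (Ei j f) x = Ei j (D i f) x.
Proof.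
rewrite /dev mean_coordC !mean_coordE; ring.
Qed.

End Cube.

(** * Iterated averages, energies and L^1 norms of differences *)

Section CubeInequalities.
Context {R : realType} (p : R) {n : nat}.
Hypotheses (p0 : 0 < p) (p1 : p < 1).
Implicit Types (f g F : cube n -> R) (x y : cube n) (i j k : 'I_n) (s T : seq 'I_n).
Implicit Types L M : R.

Local Notation E := (@biased_mean R p n).
Local Notation Ei := (@mean_coord R p n).
Local Notation D := (@dev R p n).
Local Notation nrm1 := (@norm1 R p n).
Local Notation c := (lsi_const p).

Let q0 : 0 < 1 - p. Proof. by rewrite subr_gt0. Qed.

Definition energy f : R := E (fun x => f x ^+ 2).

Definition avg s f := foldl (fun g i => Ei i g) f s.

Lemma mean_avg s f : E (avg s f) = E f.
Proof. by elim: s f => //= i s IH f; rewrite IH mean_mean_coord. Qed.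

(** [T] holds coordinates on which [f] does not depend; it grows by one with each averaging in the
    induction. *)
Lemma avg_indep s T f x y :
  (forall x y, (forall j, j \notin T -> x j = y j) -> f x = f y) ->
  (forall j, j \notin s -> j \notin T -> x j = y j) -> avg s f x = avg s f y.
Proof.
elim: s T f => [|i s IH] T f fT xy /=; first by apply: fT => j; exact: xy.
apply: (IH (i :: T)) => [u v uv|j js].
  rewrite !mean_coordE; congr (_ * _ + _ * _); apply: fT => j jT;
  by rewrite !ffunE; case: eqP => // /eqP ji; rewrite uv// inE negb_or ji.
by rewrite inE negb_or => /andP[ji]; apply: xy; rewrite inE negb_or ji.
Qed.

(** Once every coordinate is averaged out the function is constant, hence equal to its mean, which
    averaging preserves. *)
Lemma avg_enum f x : avg (enum 'I_n) f x = E f.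
Proof.
rewrite -(mean_avg (enum 'I_n) f) -[LHS](mean_cst (n := n) p); apply: eq_mean => y.
apply: (@avg_indep _ [::]) => [u v uv|j]; last by rewrite mem_enum.
by congr f; apply/ffunP => j; exact: uv.
Qed.

Lemma energy_ge0 f : 0 <= energy f.
Proof. by apply: mean_ge0 => // x; exact: sqr_ge0. Qed.

Lemma energy_dev i f : energy (D i f) = energy f - energy (Ei i f).
Proof. exact: mean_dev_sqr. Qed.

Lemma energy_dev_le i f M : (forall x, `|f x| <= M) ->
  energy (D i f) <= M * nrm1 (D i f).
Proof.
move=> fM; rewrite energy_dev.
have -> : energy (Ei i f) = E (fun x => f x * Ei i f x).
  rewrite -[RHS](mean_mean_coord p i); apply: eq_mean => x.
  by rewrite mean_coordM.
rewrite -meanB /norm1 -meanZ; apply: le_mean => // x.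
rewrite expr2 -mulrBr (le_trans (ler_norm _))// normrM.
by apply: ler_wpM2r.
Qed.

Lemma norm1_ge0 f : 0 <= nrm1 f.
Proof. by apply: mean_ge0. Qed.

(** E_i commutes with the difference in direction j and contracts L^1. *)
Lemma norm1_dev_mean_coord i j f : nrm1 (D j (Ei i f)) <= nrm1 (D j f).
Proof.
rewrite -[nrm1 (D j f)](mean_mean_coord p i); apply: le_mean => // x.
rewrite dev_mean_coord !mean_coordE (le_trans (ler_normD _ _))// !normrM.
by rewrite !(gtr0_norm p0) !(gtr0_norm q0).
Qed.

(** * Tensorization of the logarithmic Sobolev inequality *)

Lemma minkowski2 (a b d e : R) : 0 <= a -> 0 <= b -> 0 <= d -> 0 <= e ->
  p * (p * a + (1 - p) * d) ^+ 2 + (1 - p) * (p * b + (1 - p) * e) ^+ 2 <=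
  (p * Num.sqrt (p * a ^+ 2 + (1 - p) * b ^+ 2) +
   (1 - p) * Num.sqrt (p * d ^+ 2 + (1 - p) * e ^+ 2)) ^+ 2.
Proof.
move=> a0 b0 d0 e0; set u := p * a ^+ 2 + _; set v := p * d ^+ 2 + _.
have pos (z w : R) : 0 <= p * z ^+ 2 + (1 - p) * w ^+ 2.
  by rewrite addr_ge0// mulr_ge0 ?sqr_ge0// ltW.
have u0 : 0 <= u := pos _ _.
have v0 : 0 <= v := pos _ _.
(* Cauchy-Schwarz; the defect of its squared form is p(1 - p)(ae - bd)^2. *)
have cs : p * (a * d) + (1 - p) * (b * e) <= Num.sqrt u * Num.sqrt v.
  rewrite -sqrtrM// -(@ger0_norm _ (_ + _)); last first.
    by rewrite addr_ge0// mulr_ge0 ?mulr_ge0// ltW.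
  rewrite -sqrtr_sqr ler_sqrt ?mulr_ge0//.
  have /mulr_ge0 := mulr_ge0 (ltW p0) (ltW q0) => /(_ _ (sqr_ge0 (a * e - b * d))).
  by rewrite /u /v; lra.
have su := sqr_sqrtr u0; have sv := sqr_sqrtr v0.
have -> : (p * Num.sqrt u + (1 - p) * Num.sqrt v) ^+ 2 =
    p ^+ 2 * Num.sqrt u ^+ 2 + (1 - p) ^+ 2 * Num.sqrt v ^+ 2 +
    2 * (p * (1 - p)) * (Num.sqrt u * Num.sqrt v) by ring.
rewrite su sv; have pq0 := mulr_ge0 (ltW p0) (ltW q0).
by have := ler_wpM2l pq0 cs; rewrite /u /v; lra.
Qed.

(** Stated in terms of F = g^2 rather than g, because the entropy chain averages F. *)
Definition dirichlet i F := energy (D i (fun x => Num.sqrt (F x))).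

(* For [i != j] this is Minkowski's inequality in L^2 of the i-th coordinate. *)
Lemma dirichlet_mean_coord i j F : (forall x, 0 <= F x) ->
  dirichlet j (Ei i F) <= dirichlet j F.
Proof.
move=> F0; have [->|ij] := eqVneq j i.
  rewrite {1}/dirichlet (_ : energy _ = 0) ?energy_ge0//.
  rewrite /energy -[RHS](mean_cst (n := n) p); apply: eq_mean => x.
  by rewrite /dev [X in _ - X]mean_coordE !mean_coord_id; ring.
have EF0 x : 0 <= Ei i F x by exact: mean_coord_ge0.
rewrite /dirichlet !energy_dev.
have -> : energy (fun x => Num.sqrt (Ei i F x)) = energy (fun x => Num.sqrt (F x)).
  rewrite /energy (eq_mean p (g := Ei i F)) => [|x]; last exact: sqr_sqrtr.
  by rewrite mean_mean_coord; apply: eq_mean => x; rewrite sqr_sqrtr.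
rewrite lerD2l lerN2 /energy -[leLHS](mean_mean_coord p i).
apply: le_mean => // x.
rewrite !mean_coordE !(set_coordC _ _ _ ij).
set a := set_coord (set_coord x i true) j true.
set b := set_coord (set_coord x i false) j true.
set d := set_coord (set_coord x i true) j false.
set e := set_coord (set_coord x i false) j false.
have := minkowski2 (sqrtr_ge0 (F a)) (sqrtr_ge0 (F b)) (sqrtr_ge0 (F d)) (sqrtr_ge0 (F e)).
by rewrite !sqr_sqrtr.
Qed.

Definition xlnx (u : R) := u * ln u.

(** On each fibre this is [lsi_two_point] for the two values of sqrt F, whose variance there is p(1
    - p)(u - v)^2. *)
Lemma entropy_mean_coord_le i F : (forall x, 0 <= F x) ->
  E (xlnx \o F) - E (xlnx \o Ei i F) <= c * dirichlet i F.
Proof.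
move=> F0; rewrite /dirichlet energy_dev -(mean_mean_coord p i (xlnx \o F)).
rewrite /energy -(mean_mean_coord p i (fun x => Num.sqrt (F x) ^+ 2)).
rewrite -!meanB -meanZ; apply: le_mean => // x.
rewrite /xlnx /= !mean_coordE /=.
set a := F _; set b := F _.
have a0 : 0 <= a by exact: F0.
have b0 : 0 <= b by exact: F0.
have := lsi_two_point p0 p1 (sqrtr_ge0 a) (sqrtr_ge0 b); rewrite !sqr_sqrtr//.
set u := Num.sqrt a; set v := Num.sqrt b.
have aE : a = u ^+ 2 by rewrite /u sqr_sqrtr.
have bE : b = v ^+ 2 by rewrite /v sqr_sqrtr.
move=> le; rewrite !mulrA (le_trans le)// le_eqVlt; apply/orP; left; apply/eqP.
by rewrite aE bE; ring.
Qed.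

(** The entropy telescopes along the successive averages; [dirichlet_mean_coord] replaces the
    Dirichlet terms of the averaged function by those of F. *)
Lemma entropy_avg_le s F : (forall x, 0 <= F x) ->
  E (xlnx \o F) - E (xlnx \o avg s F) <= c * \sum_(i <- s) dirichlet i F.
Proof.
elim: s F => [|i s IH] F F0 /=; first by rewrite big_nil subrr mulr0.
have c0 : 0 <= c by apply: le_trans (lsi_const_ge2 p).
rewrite big_cons mulrDr -(subrKA (E (xlnx \o Ei i F))) lerD//.
  exact: entropy_mean_coord_le.
rewrite (le_trans (IH _ _))// => [x|]; first exact: mean_coord_ge0.
apply: ler_wpM2l => //; apply: ler_sum => j _; exact: dirichlet_mean_coord.
Qed.

(** Averaging g^2 over all coordinates gives the bound with |g| inside the differences; |E_i g| <=
    E_i |g| replaces |g| by g. *)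
Theorem log_sobolev g :
  E (fun x => g x ^+ 2 * ln (g x ^+ 2)) - energy g * ln (energy g) <=
  c * \sum_i energy (D i g).
Proof.
pose F x := g x ^+ 2; have F0 x : 0 <= F x by exact: sqr_ge0.
have := entropy_avg_le (enum 'I_n) F0.
have -> : E (xlnx \o avg (enum 'I_n) F) = energy g * ln (energy g).
  rewrite -[RHS](mean_cst (n := n) p); apply: eq_mean => x /=.
  by rewrite avg_enum.
move=> /le_trans; apply; rewrite big_enum /=.
apply: ler_wpM2l; first by apply: le_trans (lsi_const_ge2 p).
apply: ler_sum => i _; rewrite /dirichlet !energy_dev; apply: lerB.
  by apply: le_mean => // x; rewrite sqr_sqrtr.
apply: le_mean => // x; rewrite !mean_coordE /F !sqrtr_sqr -[leLHS]real_normK ?num_real//.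
rewrite ler_sqr ?nnegrE//; last by rewrite addr_ge0// mulr_ge0// ltW.
by rewrite (le_trans (ler_normD _ _))// !normrM (gtr0_norm p0) (gtr0_norm q0).
Qed.

(** * Entropy against the L^1 norm, and the Falik-Samorodnitsky inequality *)

Lemma sqr_ln_ge (s z : R) : 0 < s ->
  2 * (z ^+ 2 * ln s + z ^+ 2 - s * `|z|) <= z ^+ 2 * ln (z ^+ 2).
Proof.
move=> s0; have [->|z0] := eqVneq z 0; first by rewrite normr0; lra.
rewrite -(real_normK (num_real z)); have := z0; rewrite -normr_gt0.
set x := `|z| => x0.
have := ln_le_subr1 (divr_gt0 s0 x0).
rewrite ln_div// -(ler_pM2r (exprn_gt0 2 x0)).
have -> : (s / x - 1) * x ^+ 2 = s * x - x ^+ 2 by field; exact: lt0r_neq0.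
rewrite lnXn//; lra.
Qed.

(* A form, linear in L, of Ent(g^2) >= |g|_2^2 ln(|g|_2^2 / |g|_1^2). *)
Lemma entropy_ge L g :
  (L + 1) * energy g - expR L * nrm1 g ^+ 2 <=
  E (fun x => g x ^+ 2 * ln (g x ^+ 2)) - energy g * ln (energy g).
Proof.
have := energy_ge0 g; rewrite le_eqVlt => /predU1P[G0|G0].
  rewrite -G0 !mul0r mulr0 subr0 sub0r.
  have -> : E (fun x => g x ^+ 2 * ln (g x ^+ 2)) = 0.
    have /esym/psumr_eq0P G0' := G0.
    rewrite /biased_mean big1// => x _; rewrite mulrA G0' ?mul0r// => y _.
    by rewrite mulr_ge0 ?sqr_ge0 ?bias_ge0.
  by rewrite oppr_le0 mulr_ge0 ?expR_ge0 ?sqr_ge0.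
(* [sqr_ln_ge] is used with s = tu, so that 2 ln s = ln G + L; the leftover is the square (t - u
   |g|_1)^2. *)
set G := energy g in G0 *; pose t := Num.sqrt G; pose u := expR (L / 2).
have t0 : 0 < t by rewrite sqrtr_gt0.
have u0 : 0 < u by exact: expR_gt0.
have tE : t ^+ 2 = G by rewrite sqr_sqrtr// ltW.
have uE : u ^+ 2 = expR L by rewrite -expRM_natl; congr expR; field.
have le : E (fun x => 2 * (g x ^+ 2 * ln (t * u) + g x ^+ 2 - t * u * `|g x|)) <=
    E (fun x => g x ^+ 2 * ln (g x ^+ 2)).
  by apply: le_mean => // x; apply: sqr_ln_ge; exact: mulr_gt0.
have lnE : 2 * ln (t * u) = ln G + L.
  by rewrite -tE lnM// lnXn// expRK; field.
have eE : E (fun x => 2 * (g x ^+ 2 * ln (t * u) + g x ^+ 2 - t * u * `|g x|)) =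
    G * (2 * ln (t * u)) + 2 * G - 2 * (t * u * nrm1 g).
  rewrite meanZ meanB meanZ meanD -/(norm1 _ _) -/(energy g) -/G.
  rewrite (eq_mean p (g := fun x => ln (t * u) * g x ^+ 2)) => [|x]; last exact: mulrC.
  by rewrite meanZ -/(energy g) -/G /norm1; ring.
have := sqr_ge0 (t - u * nrm1 g); rewrite eE lnE in le.
rewrite -uE; move: le; rewrite -tE; lra.
Qed.

(* Log-Sobolev is applied to each martingale difference of [f] along [s]; the    *)
(* energies telescope because [dev k] commutes with [mean_coord i].              *)
Lemma energy_avg_le L s f :
  (L + 1) * (energy f - energy (avg s f)) <=
  expR L * (\sum_(i <- s) nrm1 (D i f) ^+ 2) +
  c * \sum_k (energy (D k f) - energy (D k (avg s f))).
Proof.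
elim: s f => [|i s IH] f /=.
  rewrite big_nil subrr !mulr0 add0r big1 ?mulr0// => k _; exact: subrr.
have step := le_trans (entropy_ge L (D i f)) (log_sobolev (D i f)).
have eE : \sum_k energy (D k (D i f)) = \sum_k (energy (D k f) - energy (D k (Ei i f))).
  apply: eq_bigr => k _.
  rewrite (_ : energy (D k (D i f)) = energy (D i (D k f))).
    rewrite energy_dev; congr (_ - _); apply: eq_mean => x.
    by rewrite dev_mean_coord.
  by apply: eq_mean => x; rewrite devC.
rewrite eE energy_dev in step.
have nle : \sum_(j <- s) nrm1 (D j (Ei i f)) ^+ 2 <= \sum_(j <- s) nrm1 (D j f) ^+ 2.
  apply: ler_sum => j _; rewrite ler_sqr ?nnegrE ?norm1_ge0//.
  exact: norm1_dev_mean_coord.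
have := ler_wpM2l (expR_ge0 L) nle; have := IH (Ei i f); move: step.
rewrite big_cons !sumrB; lra.
Qed.

(** With S the sum of squared L^1 norms, L = ln (var f / S) would give var f * ln (var f / S) on the
    left; a free L also covers S = 0. The energies of the differences of the final average are
    dropped by nonnegativity. *)
Theorem var_le_norm1 L f :
  (L + 1) * biased_var p f - expR L * \sum_i nrm1 (D i f) ^+ 2 <=
  c * \sum_i energy (D i f).
Proof.
have := energy_avg_le L (enum 'I_n) f; rewrite big_enum /=.
have -> : energy (avg (enum 'I_n) f) = E f ^+ 2.
  rewrite -[RHS](mean_cst (n := n) p); apply: eq_mean => x /=.
  by rewrite avg_enum.
rewrite -/(biased_var p f) => le.
have c0 : 0 <= c by apply: le_trans (lsi_const_ge2 p).
rewrite lerBlDl (le_trans le)// lerD2l; apply: ler_wpM2l => //.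
by apply: ler_sum => i _; rewrite gerBl energy_ge0.
Qed.

End CubeInequalities.

(** * The quantitative bound at fixed n, and the passage to the lower limit *)

Section Limit.
Context {R : realType}.

Lemma limn_einf_ge (u : (\bar R)^nat) (l : \bar R) :
  (\forall n \near \oo, (l <= u n)%E) -> (l <= limn_einf u)%E.
Proof.
move=> [N _ lu]; rewrite limn_einf_lim; apply: lime_ge; first exact: is_cvg_einfs.
exists N => // n /= Nn; apply: le_ereal_inf_tmp => _ [k /= nk <-].
by apply: lu => /=; exact: leq_trans Nn nk.
Qed.

Lemma biased_var_le (p : R) n (f : cube n -> R) (M : R) : 0 < p -> p < 1 ->
  (forall x, `|f x| <= M) -> biased_var p f <= M ^+ 2.
Proof.
move=> p0 p1 fM; rewrite /biased_var lerBlDr (@le_trans _ _ (M ^+ 2))//; last first.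
  by rewrite lerDl sqr_ge0.
rewrite -[leRHS](mean_cst (n := n) p); apply: le_mean => // x.
rewrite -(real_normK (num_real (f x))) ler_sqr ?nnegrE//.
exact: le_trans (normr_ge0 _) (fM x).
Qed.

Lemma normr_le_norm_sup n (f : cube n -> R) x : `|f x| <= norm_sup f.
Proof. exact: (le_bigmax 0 (fun x => `|f x|)). Qed.

Lemma maxnorm1_ge0 (p : R) n (f : cube n -> R) : 0 <= maxnorm1 p f.
Proof. by rewrite /maxnorm1; elim/big_rec: _ => // i x _ x0; rewrite le_max x0 orbT. Qed.

(* Apply [var_le_norm1] with [L = 9/10 ln n]: if [k] were not a lower bound, then  *)
(* [expR L * n * m ^+ 2] would be at most the variance, where [m = maxnorm1 p f],   *)
(* and [L * var f <= lsi_const p * M * n * m < 2 * (9/20) * var f * ln n], a        *)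
(* contradiction. The condition on [d] absorbs [ln n <= 40 * n `^ (1/40)].          *)
(* than the variance, and [var_le_norm1] becomes contradictory.                 *)
Lemma maxnorm1_ge (p : R) n (f : cube n -> R) (M d : R) :
  let k := 9 / 20 * M^-1 * (1 / (1 + `|ln (p / (1 - p))|)) in
  0 < p -> p < 1 -> (1 < n)%N -> 0 < M -> (forall x, `|f x| <= M) ->
  0 < biased_var p f -> biased_var p f <= d * n%:R `^ (1 / 20) ->
  d * k ^+ 2 * 1600 <= 1 ->
  k <= maxnorm1 p f / (biased_var p f * (ln n%:R / n%:R)).
Proof.
move=> k p0 p1 n1 M0 fM v0 vd dk.
set v := biased_var p f in v0 vd *; set m := maxnorm1 p f; set l := ln n%:R.
have N0 : (0 : R) < n%:R by rewrite ltr0n ltnW.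
have l0 : 0 < l by rewrite ln_gt0// ltr1n.
rewrite leNgt; apply/negP; rewrite ltr_pdivrMr; last by rewrite mulr_gt0// divr_gt0.
rewrite !mulrA ltr_pdivlMr// => mlt.
have m0 : 0 <= m by exact: maxnorm1_ge0.
have mi i : norm1 p (dev p i f) <= m.
  exact: (le_bigmax 0 (fun i => norm1 p (dev p i f))).
set t := `|ln (p / (1 - p))| in k dk mlt *.
have t0 : 0 <= t by exact: normr_ge0.
have k0 : 0 < k by rewrite !mulr_gt0// ?invr_gt0//; lra.
have c0 : 0 < lsi_const p by rewrite /lsi_const -/t; lra.
have cMk : lsi_const p * M * k = 9 / 10.
  by rewrite /k /lsi_const -/t; field; rewrite !lt0r_neq0//; lra.
clearbody k.
(* w = n^(1/40) turns every power of n below into an integer power of w, and ln n <= 40 w. *)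
pose w := expR (l / 40).
have w0 : 0 < w by exact: expR_gt0.
have wl : l <= 40 * w by have := expR_ge1Dx (l / 40); rewrite -/w; lra.
have wE : w ^+ 40 = n%:R.
  by rewrite -expRM_natl -[RHS]lnK ?posrE//; congr expR; rewrite -/l; field.
have w2 : n%:R `^ (1 / 20) = w ^+ 2.
  by rewrite /powR gt_eqF// -expRM_natl; congr expR; rewrite -/l; field.
have w36 : expR (9 / 10 * l) = w ^+ 36.
  by rewrite -expRM_natl; congr expR; field.
have l2 : l ^+ 2 <= 1600 * w ^+ 2.
  have -> : 1600 * w ^+ 2 = (40 * w) ^+ 2 by ring.
  by rewrite ler_sqr ?nnegrE ?mulr_ge0// ltW.
rewrite w2 in vd.
(* The left side is (mn)^2 / w^4. By the assumed upper bound mn < kvl, together with v <= d w^2 and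
   l^2 <= 1600 w^2, it is at most (1600 d k^2) v. *)
have small : expR (9 / 10 * l) * (n%:R * m ^+ 2) <= v.
  rewrite -(ler_pM2r (exprn_gt0 4 w0)) w36.
  have -> : w ^+ 36 * (n%:R * m ^+ 2) * w ^+ 4 = (m * n%:R) ^+ 2.
    by rewrite -wE; ring.
  apply: (@le_trans _ _ ((k * v * l) ^+ 2)).
    have kvl0 : 0 <= k * v * l by apply/ltW; rewrite !mulr_gt0.
    have mn0 : 0 <= m * n%:R by rewrite mulr_ge0// ltW.
    by rewrite ler_sqr// ltW.
  have kv0 : 0 <= k ^+ 2 * v by rewrite mulr_ge0 ?sqr_ge0// ltW.
  apply: (@le_trans _ _ (k ^+ 2 * v * (d * w ^+ 2 * (1600 * w ^+ 2)))).
    have -> : (k * v * l) ^+ 2 = k ^+ 2 * v * (v * l ^+ 2) by ring.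
    apply: ler_wpM2l => //; apply: ler_pM => //; [exact: ltW | exact: sqr_ge0].
  have -> : k ^+ 2 * v * (d * w ^+ 2 * (1600 * w ^+ 2)) =
    (d * k ^+ 2 * 1600) * (v * w ^+ 4) by ring.
  by apply: ler_piMl => //; rewrite mulr_ge0 ?exprn_ge0// ltW.
have main := var_le_norm1 p0 p1 (9 / 10 * l) f.
have s1 : \sum_i norm1 p (dev p i f) ^+ 2 <= n%:R * m ^+ 2.
  rewrite mulr_natl -[X in _ *+ X](card_ord n) -sumr_const.
  by apply: ler_sum => i _; rewrite ler_sqr ?nnegrE ?norm1_ge0.
have s2 : \sum_i energy p (dev p i f) <= n%:R * (M * m).
  rewrite mulr_natl -[X in _ *+ X](card_ord n) -sumr_const.
  apply: ler_sum => i _; apply: (le_trans (energy_dev_le p0 p1 i fM)).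
  by apply: ler_wpM2l (mi i); exact: ltW.
have := ler_wpM2l (expR_ge0 (9 / 10 * l)) s1.
have := ler_wpM2l (ltW c0) s2.
have cM : 0 < lsi_const p * M by rewrite mulr_gt0.
have := mlt; rewrite -(ltr_pM2l cM).
have -> : lsi_const p * M * (k * v * l) = 9 / 10 * l * v by rewrite -cMk; ring.
(* The summand 1 in L + 1 pays for [small], leaving L v <= c M n m < L v, where c is
   [lsi_const p]. *)
move: main; rewrite -/v; lra.
Qed.

End Limit.

Theorem mainTheorem2 (R : realType) (p : R) (f : forall n : nat, cube n -> R) :
  0 < p -> p < 1 ->
  (forall n : nat, (1 <= n)%N -> 0 < biased_var p (f n)) ->
  (forall e : R, 0 < e ->
     (fun n : nat => biased_var p (f n) : R^o) =o_\oo
       (fun n : nat => n%:R `^ e : R^o)) ->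
  ((9 / 20 : R)%:E *
     (ereal_sup [set (norm_sup (f n))%:E | n in [set n : nat | (1 <= n)%N]])^-1 *
     (1 / (1 + `|ln (p / (1 - p))|))%:E
   <= limn_einf (fun n : nat =>
        (maxnorm1 p (f n) / (biased_var p (f n) * (ln n%:R / n%:R)))%:E))%E.
Proof.
move=> p0 p1 var0 varo; set S := ereal_sup _.
have supS n : (1 <= n)%N -> ((norm_sup (f n))%:E <= S)%E.
  by move=> n1; apply: ereal_sup_ubound; exists n.
case: S supS => [M| |] supS; last by have := supS 1%N isT.
- have fM n : (1 <= n)%N -> forall x, `|f n x| <= M.
    move=> n1 x; have := supS n n1; rewrite lee_fin; apply: le_trans.
    exact: normr_le_norm_sup.
  (* If M were 0, the variance at n = 1 would vanish. *)
  have M0 : 0 < M.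
    have Mge0 : 0 <= M by apply: le_trans (fM 1%N isT [ffun=> true]).
    have := lt_le_trans (var0 1%N isT) (biased_var_le p0 p1 (fM 1%N isT)).
    by rewrite lt0r Mge0 andbT; apply: contraTneq => ->; rewrite expr0n ltxx.
  rewrite inver gt_eqF// -!EFinM; set k := (X in X%:E).
  have k0 : 0 < k.
    have := normr_ge0 (ln (p / (1 - p))) => t0.
    by rewrite !mulr_gt0// ?invr_gt0//; lra.
  (* The largest d allowed by [maxnorm1_ge]; the little-o hypothesis is used only for exponent 1/20
     with this d. *)
  pose d := (k ^+ 2 * 1600)^-1.
  have k1 : 0 < k ^+ 2 * 1600 by have := exprn_gt0 2 k0; lra.
  have d0 : 0 < d by rewrite invr_gt0.
  have dk : d * k ^+ 2 * 1600 <= 1 by rewrite -mulrA (mulVf (lt0r_neq0 k1)).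
  have e0 : 0 < 1 / 20 :> R by lra.
  apply: limn_einf_ge; have /eqoP/(_ d d0) vo := varo _ e0.
  near=> n; rewrite lee_fin.
  have n1 : (1 < n)%N by near: n; exists 2%N.
  have vn : biased_var p (f n) <= d * n%:R `^ (1 / 20).
    have : `|biased_var p (f n)| <= d * `|n%:R `^ (1 / 20)| by near: n.
    by rewrite (ger0_norm (powR_ge0 _ _)); apply: le_trans; exact: ler_norm.
  exact: (maxnorm1_ge p0 p1 n1 M0 (fM n (ltnW n1)) (var0 n (ltnW n1)) vn dk).
(* Infinite supremum: the bound is 0 and the ratios are nonnegative. *)
- rewrite invey mule0 mul0e; apply: limn_einf_ge; exists 1%N => // n /= n1.
  rewrite lee_fin divr_ge0 ?maxnorm1_ge0// mulr_ge0//; first exact: ltW (var0 _ n1).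
  by rewrite divr_ge0// ln_ge0// ler1n.
Unshelve. all: by end_near.
Qed.
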